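(* For every sufficiently large integer $r$, there exists a constant $\eta_r>0$ such that, for infinitely many integers $n$, there is an $r$-edge-colouring of the complete graph $K_n$ in which every collection of at most $r$ vertex-disjoint monochromatic paths leaves at least $\eta_r n$ vertices uncovered.
   Context: An $r$-edge-colouring of $K_n$ assigns to each edge one of $r$ colours (not necessarily properly, and not all colours need be used). A monochromatic path is a path all of whose edges have the same colour; a single vertex counts as a (trivial) monochromatic path. A vertex is uncovered by a collection of paths if it lies on none of them. *)

(* Defs.v *)
From mathcomp Require Import all_boot all_order all_algebra.
From mathcomp Require Import reals.
Set Implicit Arguments.
Unset Strict Implicit.
Unset Printing Implicit Defensive.

(* The value on the diagonal carries no information: paths below have no
   repeated vertex, so only colours of pairs of distinct vertices are used. *)
Record edge_colouring (r n : nat) := EdgeColouring {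
  colour :> 'I_n -> 'I_n -> 'I_r;
  colour_sym : forall x y, colour x y = colour y x }.

(* A path is the nonempty duplicate-free sequence of its vertices, in order;
   any such sequence is a path of K_n. *)
Definition monochromatic_path (r n : nat) (c : edge_colouring r n)
    (p : seq 'I_n) : Prop :=
  [/\ p != [::], uniq p & exists k : 'I_r, sorted (fun x y => c x y == k) p].

(* Since each path is itself duplicate-free, uniq (flatten P) expresses exactly
   that distinct members of P share no vertex. *)
Definition disjoint_monochromatic_paths (r n : nat) (c : edge_colouring r n)
    (P : seq (seq 'I_n)) : Prop :=
  (forall p, p \in P -> monochromatic_path c p) /\ uniq (flatten P).

Definition uncovered (n : nat) (P : seq (seq 'I_n)) : {set 'I_n} :=
  [set v | ~~ has (fun p => v \in p) P].

(* Main.v *)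
Require Import Defs.
From mathcomp Require Import all_boot all_order all_algebra.
From mathcomp Require Import reals.
From mathcomp Require Import zify ring lra.
Set Implicit Arguments.
Unset Strict Implicit.
Unset Printing Implicit Defensive.
Import Order.TTheory GRing.Theory Num.Theory.

(** The vertices of K_n are divided into m parts of equal size, where m exceeds
    the number r of colours by a fixed proportion.  A tournament on the parts
    makes one part of each pair the centre and the other the leaf.  A vertex y
    assigns distinct colours to the centres of its part, and all edges from y
    to such a centre i get the colour that y assigned to i; the edges inside a
    part get a colour in which that part is a centre.  Every monochromatic
    component then consists of one centre part i and of the vertices that
    assigned one given colour c to i; all its edges meet the part i.  Hence a
    path inside it covers at most one more vertex outside the part i than inside
    ([leaf_edge_centre], [path_count_le]).

    Any r paths single out at most r such pairs (c, i), so at least m - r parts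
    j are not the centre of any of the chosen components, and apart from
    the at most r vertices that form a path on their own, a vertex y of such a
    part can only be covered through a chosen pair (c, i) for which y assigned c
    to i.  The vertices of a part realise all outcomes of a greedy random
    assignment in which every centre receives one of d available colours, d
    being proportional to r.  Call a centre overloaded if more than d/2 of its
    colours are chosen; there are at most 2r/d of them, a bounded number, and
    the overloaded parts, being so few, can help to cover only as many vertices
    as they contain.  At all the other centres together, y avoids the at most r
    chosen pairs with a probability that is bounded below independently of r
    ([greedy_avoid_card], [prod_subn_ge]).  So the vertices that meet the chosen
    components only at overloaded centres fill a number of parts proportional to
    m - r, which by far exceeds 2r/d for large r, and a positive proportion of the
    vertices stays uncovered ([scheme_uncovered]).

    It remains to have more parts than colours although a vertex has about m/2
    centres, must give them distinct colours, needs d spare colours at each of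
    these choices, and must not use the colours in which its own part is a
    centre.  The 400a parts are arranged in 100 groups, each made of two halves
    of 2a parts.  The centres that a vertex sees in another group form exactly
    one half of it, so 3a colours per group leave d = a free choices.  Pairs of
    parts in the same group are few, and at most 40a additional colours
    distributed by a parity code are enough for them ([grid_pool_room]).  This
    uses at most 340a colours, and a is chosen so that r lies between 360a and
    361a. *)

(** * Products of proportions bounded away from zero *)

Section ProductBound.
Local Open Scope ring_scope.

Lemma bernoulli_ineq (F : realFieldType) (x : F) (n : nat) :
  -1 <= x -> 1 + n%:R * x <= (1 + x) ^+ n.
Proof.
move=> x_ge; elim: n => [|n IHn]; first by rewrite expr0; lra.
have x1_ge0 : 0 <= 1 + x by lra.
rewrite exprS; apply: le_trans (ler_wpM2l x1_ge0 IHn).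
have n_ge0 : 0 <= n%:R :> F by [].
by rewrite -natr1; nra.
Qed.

Lemma expr_1Dinv_le4 (F : realFieldType) (d : nat) :
  (0 < d)%N -> (1 + d%:R^-1) ^+ d <= 4 :> F.
Proof.
move=> d_gt0; have dR : 0 < d%:R :> F by rewrite ltr0n.
set y : F := 1 - d.+1%:R^-1.
have d1R : 0 < d.+1%:R :> F by rewrite ltr0n.
have d1E : d.+1%:R = d%:R + 1 :> F by rewrite -natr1.
have yE : 1 + d%:R^-1 = y^-1 :> F.
  by rewrite /y d1E; field; rewrite ?lt0r_neq0 //; lra.
have y_gt0 : 0 < y by rewrite -invr_gt0 -yE; have := invr_gt0 (d%:R : F); lra.
have half : 2^-1 <= y ^+ uphalf d.
  have := @bernoulli_ineq F (- d.+1%:R^-1) (uphalf d).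
  rewrite -/y lerN2 invf_le1 // ler1n => /(_ isT); apply: le_trans.
  have : ((uphalf d)%:R *+ 2 : F) <= d.+1%:R.
    by rewrite -mulrnA ler_nat; lia.
  move=> le2; rewrite mulrN; set v := _ / _; suff: v <= 2^-1 by lra.
  by rewrite ler_pdivrMr //; lra.
have y_le1 : y <= 1 by rewrite /y lerBlDr lerDl invr_ge0 ltW.
have quarter : 4^-1 <= y ^+ d.
  apply: (@le_trans _ _ (y ^+ (uphalf d).*2)); last first.
    apply: ler_wiXn2l; [exact: ltW| exact: y_le1 |by rewrite -leq_uphalf_double].
  have := @ler_pM F 2^-1 _ 2^-1 _ _ _ half half.
  rewrite -addnn exprD invr_ge0 => H; apply: le_trans (H _ _); rewrite ?ler0n //.
  by rewrite -invfM -natrM.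
by rewrite yE exprVn -[leRHS]invrK lef_pV2 ?posrE ?exprn_gt0 ?invr_gt0.
Qed.

(** If every [n i] is at most [d/2], then the factor [1 - n i / d] is at least
    [(1 + 1/d) ^- (2 * n i)], because [(1 - u) * (1 + u) ^ 2 >= 1] for
    [0 <= u <= 1/2] and [1 + n/d <= (1 + 1/d) ^ n].  Only the sum of the [n i]
    then matters, and the proportion of [d ^ #|I|] that is kept does not depend
    on the number of factors. *)
Lemma prod_subn_ge (I : finType) (n : I -> nat) (d L : nat) :
    (0 < d)%N -> (forall i, (n i).*2 <= d)%N -> (\sum_i n i <= L * d)%N ->
  (d ^ #|I| <= 16 ^ L * \prod_i (d - n i))%N.
Proof.
move=> d_gt0 n_le sum_le.
have dR : 0 < d%:R :> rat by rewrite ltr0n.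
have d0 : d%:R != 0 :> rat by rewrite lt0r_neq0.
set x : rat := 1 + d%:R^-1.
have x_ge1 : 1 <= x by rewrite lerDl invr_ge0 ltW.
have factor i : (d%:R : rat) <= (d - n i)%:R * x ^+ (n i).*2.
  have n_le_d : (n i <= d)%N by have := n_le i; lia.
  set u : rat := (n i)%:R / d%:R.
  have u_ge0 : 0 <= u by rewrite divr_ge0.
  have u_le : u <= 2^-1.
    by rewrite ler_pdivrMr // ler_pdivlMl // -natrM ler_nat mul2n.
  have -> : (d - n i)%:R = d%:R * (1 - u) :> rat.
    by rewrite natrB // /u; field.
  have le_x : 1 + u <= x ^+ n i.
    by apply: bernoulli_ineq; rewrite (@le_trans _ _ 0) // invr_ge0 ltW.
  rewrite -addnn exprD -{1}[d%:R]mulr1 -mulrA ler_pM2l //.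
  have sq : (1 + u) * (1 + u) <= x ^+ n i * x ^+ n i by apply: ler_pM => //; lra.
  have : (1 - u) * ((1 + u) * (1 + u)) <= (1 - u) * (x ^+ n i * x ^+ n i).
    by apply: ler_wpM2l => //; lra.
  by apply: le_trans; nra.
have prod_le : (d%:R ^+ #|I| : rat) <= (\prod_i (d - n i)%:R) * x ^+ (\sum_i n i).*2.
  have -> : x ^+ (\sum_i n i).*2 = \prod_i x ^+ (n i).*2.
    by rewrite prodrXr -mul2n big_distrr /=;
      congr (_ ^+ _); apply: eq_bigr => i _; rewrite mul2n.
  rewrite -prodr_const -big_split /=.
  by apply: ler_prod => i _; rewrite ler0n factor.
have x_le : x ^+ (\sum_i n i).*2 <= 16 ^+ L.
  apply: (@le_trans _ _ (x ^+ (d * L.*2))).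
    by apply: ler_weXn2l => //; lia.
  rewrite exprM; have -> : 16 ^+ L = 4 ^+ L.*2 :> rat.
    by rewrite -mul2n exprM.
  by apply: lerXn2r; rewrite ?nnegrE ?exprn_ge0 ?expr_1Dinv_le4 //; lra.
rewrite -(ler_nat rat) natrM !natrX mulrC natr_prod.
by apply: le_trans prod_le _; apply: ler_wpM2l => //; apply: prodr_ge0.
Qed.

End ProductBound.

(** * Greedy assignments of colours *)

Lemma card_tuple_cons (T : finType) (n : nat) (P : pred (n.+1.-tuple T)) :
  #|[set w | P w]| = \sum_(a : T) #|[set w : n.-tuple T | P (cons_tuple a w)]|.
Proof.
pose f (u : T * n.-tuple T) := cons_tuple u.1 u.2.
pose g (w : n.+1.-tuple T) := (thead w, [tuple of behead w]).
have fK : cancel f g.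
  by case=> a w; rewrite /g /f theadE; congr (_, _); apply/val_inj.
have gK : cancel g f by move=> w; rewrite [RHS]tuple_eta; apply/val_inj.
rewrite -sum1dep_card (reindex f) /=; last first.
  by exists g => x _; [exact: fK | exact: gK].
by under [RHS]eq_bigr do rewrite -sum1dep_card; rewrite pair_big_dep.
Qed.

Section Greedy.
Variables (J Col : finType) (d : nat) (c0 : Col) (pool : J -> {set Col}).

(** The colour of each element of a list is chosen in turn from its pool, a
    letter of the word [w] selecting one of [d] colours that were not used
    before.  Uniform words give every new choice [d] outcomes of equal
    weight whatever was chosen earlier, which the uniform distribution on all
    injective choices would not. *)
Definition available (i : J) (h : seq Col) := [seq c <- enum (pool i) | c \notin h].

Fixpoint greedy (s : seq J) (w : seq 'I_d) (h : seq Col) : J -> Col :=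
  if s is i :: s' then if w is a :: w' then
    let c := nth c0 (available i h) a in
    fun i1 => if i1 == i then c else greedy s' w' (c :: h) i1
  else fun=> c0 else fun=> c0.

Definition overlap (i i1 : J) := ~~ [disjoint pool i1 & pool i].

(** Only elements with a pool meeting that of [i] can use up colours of [i], so
    it is their number, and not the length of [s], that the pool has to exceed.
    This is what allows fewer colours than parts. *)
Definition roomy (s : seq J) (h : seq Col) :=
  forall i, i \in s ->
    d + count (mem (pool i)) h + count (overlap i) s <= #|pool i|.

Lemma size_available i h :
  #|pool i| <= size (available i h) + count (mem (pool i)) h.
Proof.
rewrite size_filter cardE -(count_predC (fun c => c \notin h)) leq_add2l.
rewrite -!size_filter; apply: uniq_leq_size; first by rewrite filter_uniq ?enum_uniq.
by move=> c; rewrite !mem_filter /= negbK => /and3P[-> ->].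
Qed.

Lemma roomy_size i s h : roomy (i :: s) h -> d <= size (available i h).
Proof.
by move=> /(_ i (mem_head _ _)); have := size_available i h; lia.
Qed.

(** A colour used by [i] costs [i1] a place in its pool only if the two pools
    meet, and then [i] also leaves the list of elements still to be coloured. *)
Lemma roomy_cons i s h c :
  uniq (i :: s) -> roomy (i :: s) h -> c \in pool i -> roomy s (c :: h).
Proof.
move=> /andP[_ _] room ci i1 i1s; have := room i1.
rewrite inE i1s orbT => /(_ isT) /=.
have : (c \in pool i1) <= overlap i1 i.
  case: (boolP (c \in pool i1)) => // ci1; rewrite lt0b /overlap.
  by apply/pred0Pn; exists c; rewrite /= ci ci1.
by lia.
Qed.

Lemma nth_available i s h (a : 'I_d) : roomy (i :: s) h ->
  nth c0 (available i h) a \in pool i /\ nth c0 (available i h) a \notin h.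
Proof.
move=> /roomy_size le_size; have := ltn_ord a => a_lt.
have /mem_nth-/(_ c0) : a < size (available i h) by lia.
by rewrite mem_filter mem_enum => /andP[].
Qed.

Lemma greedy_pool s w h i : uniq s -> roomy s h -> size s <= size w ->
  i \in s -> greedy s w h i \in pool i /\ greedy s w h i \notin h.
Proof.
elim: s w h => // i0 s IHs [//|a w] h us room /= sz.
have [nth_pool nth_h] := nth_available a room.
rewrite inE; case: eqVneq => [-> _ //|ne /= si].
have us' : uniq s by case/andP: us.
have [IH1 IH2] := IHs w _ us' (roomy_cons us room nth_pool) sz si.
by split=> //; apply: contra IH2 => Hh; rewrite inE Hh orbT.
Qed.

Lemma greedy_inj s w h : uniq s -> roomy s h -> size s <= size w ->
  {in s &, injective (greedy s w h)}.
Proof.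
elim: s w h => // i0 s IHs [//|a w] h us room /= sz.
have [nth_pool _] := nth_available a room.
have room' := roomy_cons us room nth_pool.
have us' : uniq s by case/andP: us.
have fresh i : i \in s -> greedy s w (nth c0 (available i0 h) a :: h) i
    <> nth c0 (available i0 h) a.
  move=> si; have [_] := greedy_pool us' room' sz si.
  by rewrite inE => /norP[/eqP].
move=> i1 i2; rewrite !inE.
case: (eqVneq i1 i0) => [->|ne1] /=; case: (eqVneq i2 i0) => [->|ne2] //= s1 s2.
- by move=> /esym /fresh -/(_ s2).
- by move=> /fresh -/(_ s1).
- by apply: IHs.
Qed.

(** At each step at most [#|forb i|] of the [d] letters lead into the forbidden
    set, whatever the previous letters were. *)
Lemma greedy_avoid_card s n h (forb : J -> {set Col}) :
    uniq s -> roomy s h -> size s <= n ->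
  (\prod_(i <- s) (d - #|forb i|)) * d ^ (n - size s) <=
  #|[set w : n.-tuple 'I_d | all (fun i => greedy s w h i \notin forb i) s]|.
Proof.
elim: s n h => [|i s IHs] n h us room.
  move=> _; rewrite big_nil mul1n subn0 /= -{1}(card_ord d) -card_tuple.
  by rewrite -cardsT subset_leq_card //; apply/subsetP => w; rewrite !inE.
case: n => // n; rewrite ltnS subSS => sz.
rewrite card_tuple_cons big_cons.
pose good (a : 'I_d) := nth c0 (available i h) a \notin forb i.
have le_size := roomy_size room.
have good_card : d - #|forb i| <= #|[set a | good a]|.
  have := cardsC [set a | good a]; rewrite card_ord.
  suff : #|~: [set a | good a]| <= #|forb i| by lia.
  rewrite -(card_in_imset (f := fun a : 'I_d => nth c0 (available i h) a)).
    by apply/subset_leq_card/subsetP => c /imsetP[a]; rewrite !inE negbK => ? ->.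
  move=> a b _ _ /eqP; have := ltn_ord a; have := ltn_ord b => lb la.
  rewrite nth_uniq ?(leq_trans _ le_size) //; first by move=> /eqP /val_inj.
  exact/filter_uniq/enum_uniq.
rewrite -mulnA; apply: leq_trans (leq_mul good_card (leqnn _)) _.
rewrite -sum1dep_card big_distrl /= [leqRHS](bigID good) /=.
apply: leq_trans (leq_addr _ _); apply: leq_sum => a good_a; rewrite mul1n.
have [nth_pool _] := nth_available a room.
have us' : uniq s by case/andP: us.
apply: leq_trans (IHs n _ us' (roomy_cons us room nth_pool) sz) _.
apply/subset_leq_card/subsetP => w; rewrite !inE /= eqxx (good_a : _ \notin _) /=.
move=> /allP ok; apply/allP => i1 s1; case: eqVneq => [ii1|_]; last exact: ok.
by move: us; rewrite -ii1 /= s1.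
Qed.

End Greedy.

(** * Colourings whose components are centred *)

(** Every element of [a] on the path, except possibly the last vertex, is
    followed by an element of [b]. *)
Lemma path_count_le (T : eqType) (e : rel T) (a b : pred T) (p : seq T) :
    (forall x y, e x y -> a x -> b y) -> sorted e p ->
  count a p <= (count b p).+1.
Proof.
move=> ab; case: p => // x p /= e_p.
suff : a x + count a p <= (count b p).+1 by lia.
elim: p x e_p => [|y p IHp] x /=; first by case: (a x).
move=> /andP[exy /IHp]; have := ab _ _ exy.
by case: (a x) => [/(_ isT) ->|_]; lia.
Qed.

(** [leaf j i] makes [i] the centre and [j] the leaf of the pair.  The colours
    in [own i] are those in which the part [i] may be a centre; a part is never
    a leaf in its own colours, so that no edge of colour [c] joins two different
    parts that own [c]. *)
Record scheme (J Col : finType) (d : nat) := Scheme {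
  leaf : rel J;
  own : J -> {set Col};
  pool : J -> J -> {set Col};
  home : J -> Col;
  leaf_tournament : forall i j, i != j -> leaf i j = ~~ leaf j i;
  home_own : forall i, home i \in own i;
  pool_sub : forall j i, leaf j i -> pool j i \subset own i :\: own j;
  pool_room : forall j i, leaf j i ->
    d + #|[set i1 | leaf j i1 && overlap (pool j) i i1]| <= #|pool j i| }.

Section SchemeColouring.
Variables (J Col : finType) (d z : nat) (S : scheme J Col d).

Definition dye (j : J) (w : seq 'I_d) : J -> Col :=
  greedy (home S j) (pool S j) (enum (leaf S j)) w [::].

Lemma roomy_leaf j : roomy d (pool S j) (enum (leaf S j)) [::].
Proof.
move=> i; rewrite mem_enum => ji; rewrite /= addn0.
apply: leq_trans (pool_room ji); rewrite leq_add2l -size_filter cardE.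
apply: uniq_leq_size => [|i1]; first exact/filter_uniq/enum_uniq.
by rewrite mem_filter !mem_enum inE => /andP[ov lf]; apply/andP.
Qed.

Lemma size_enum_leaf j : size (enum (leaf S j)) <= #|J|.
Proof. by rewrite -cardE max_card. Qed.

Definition vertex : finType := (J * #|J|.-tuple 'I_d * 'I_z)%type.
Implicit Types x y : vertex.
Definition part x : J := x.1.1.
Definition word x : #|J|.-tuple 'I_d := x.1.2.

Definition shade x y : Col :=
  if part x == part y then home S (part x)
  else if leaf S (part x) (part y) then dye (part x) (word x) (part y)
  else dye (part y) (word y) (part x).

Lemma shadeC x y : shade x y = shade y x.
Proof.
rewrite /shade eq_sym; case: eqVneq => [->//|ne].
by rewrite (leaf_tournament S ne); case: (leaf S (part x) _).
Qed.

Lemma dye_pool x i : leaf S (part x) i ->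
  dye (part x) (word x) i \in own S i :\: own S (part x).
Proof.
move=> xi; apply: (subsetP (pool_sub xi)).
have le_size : size (enum (leaf S (part x))) <= size (word x).
  by rewrite size_tuple size_enum_leaf.
have mem_i : i \in enum (leaf S (part x)) by rewrite mem_enum.
by have [] := greedy_pool (home S (part x)) (enum_uniq _)
  (@roomy_leaf (part x)) le_size mem_i.
Qed.

Lemma dye_inj x i1 i2 : leaf S (part x) i1 -> leaf S (part x) i2 ->
  dye (part x) (word x) i1 = dye (part x) (word x) i2 -> i1 = i2.
Proof.
move=> x1 x2; apply: (greedy_inj (enum_uniq _) (@roomy_leaf (part x))).
- by rewrite size_tuple size_enum_leaf.
- by rewrite mem_enum.
- by rewrite mem_enum.
Qed.

(** For [q = (c, i)]: membership in the component of colour [c] around the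
    centre [i]. *)
Definition inhabits (q : Col * J) x :=
  (part x == q.2) && (q.1 \in own S q.2)
  || leaf S (part x) q.2 && (dye (part x) (word x) q.2 == q.1).

(** In each colour a vertex belongs to at most one component, either as a member
    of a centre or as a leaf, by the injectivity of [dye]. *)
Lemma inhabits_uniq c i1 i2 x :
  inhabits (c, i1) x -> inhabits (c, i2) x -> i1 = i2.
Proof.
rewrite /inhabits /=.
case/orP=> [/andP[/eqP<- c1]|/andP[l1 /eqP d1]];
  case/orP=> [/andP[/eqP e2 c2]|/andP[l2 /eqP d2]] //.
- by have := dye_pool l2; rewrite d2 inE c1.
- by have := dye_pool l1; rewrite d1 e2 inE c2.
- by apply: (dye_inj l1 l2); rewrite d1 d2.
Qed.

Lemma shade_inhabits x y :
  exists i, inhabits (shade x y, i) x && inhabits (shade x y, i) y.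
Proof.
rewrite /shade /inhabits /=; case: eqVneq => [exy|ne].
  by exists (part y); rewrite exy eqxx home_own.
case: ifP => [lxy|nlxy].
  exists (part y); rewrite lxy !eqxx orbT /=.
  by have := dye_pool lxy; rewrite inE => /andP[_ ->].
have lyx : leaf S (part y) (part x) by rewrite leaf_tournament 1?eq_sym // nlxy.
exists (part x); rewrite lyx !eqxx orbT /= andbT.
by have := dye_pool lyx; rewrite inE => /andP[_ ->].
Qed.

Definition component_edge (q : Col * J) x y :=
  [&& shade x y == q.1, inhabits q x & inhabits q y].

Lemma monochromatic_component (k : Col) (p : seq vertex) (j0 : J) :
  sorted (fun x y => shade x y == k) p ->
  exists q, sorted (component_edge q) p.
Proof.
case: p => [|x [|y p]]; [by exists (k, j0)|by exists (k, j0)|].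
move=> /= /andP[/eqP xy yp]; have [i] := shade_inhabits x y.
rewrite xy => /andP[ix iy]; exists (k, i) => /=.
rewrite {1}/component_edge xy eqxx ix iy /= {x xy ix}.
elim: p y iy yp => //= y' p IHp y iy /andP[/eqP yy' yp].
have [i'] := shade_inhabits y y'; rewrite yy' => /andP[i'y i'y'].
have ii' := inhabits_uniq i'y iy; rewrite ii' in i'y'.
by rewrite /component_edge yy' eqxx iy i'y' /= IHp.
Qed.

(** The component around [i] has no edge between two vertices outside [i]: the
    colour [c] that [x] assigned to [i] belongs to no other centre of [x], nor
    to the part of [x] itself. *)
Lemma leaf_edge_centre c i x y : part x != i ->
  component_edge (c, i) x y ->
  [/\ leaf S (part x) i, dye (part x) (word x) i = c & part y = i].
Proof.
move=> xi /and3P[/= /eqP xy]; rewrite {1}/inhabits /= (negPf xi) /=.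
move=> /andP[lx /eqP dx] _; split=> //; move: xy; rewrite /shade.
have := dye_pool lx; rewrite dx inE => /andP[cx _].
case: eqVneq => [_ hc|ne]; first by rewrite -hc home_own in cx.
case: ifP => [lxy|nlxy]; first by rewrite -dx => /(dye_inj lxy lx).
have lyx : leaf S (part y) (part x) by rewrite leaf_tournament 1?eq_sym // nlxy.
by have := dye_pool lyx => /[swap] ->; rewrite inE (negPf cx) andbF.
Qed.

Lemma card_part (j : J) (A : pred (#|J|.-tuple 'I_d)) :
  #|[set x : vertex | (part x == j) && A (word x)]| = #|[set w | A w]| * z.
Proof.
have -> : [set x : vertex | (part x == j) && A (word x)]
    = setX (setX [set j] [set w | A w]) [set: 'I_z].
  by apply/setP => -[[j' w] q]; rewrite !inE andbT.
by rewrite !cardsX cards1 mul1n cardsT card_ord.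
Qed.

Lemma card_parts (B : {set J}) :
  #|[set x : vertex | part x \in B]| = #|B| * (d ^ #|J| * z).
Proof.
have -> : [set x : vertex | part x \in B] = setX (setX B setT) setT.
  by apply/setP => -[[j' w] q]; rewrite !inE !andbT.
by rewrite !cardsX !cardsT card_ord card_tuple card_ord mulnA.
Qed.

(** The factors of the parts that are not centres of [j] only weaken the bound;
    including them makes it the same for all [j]. *)
Lemma dye_avoid_card (j : J) (forb : J -> {set Col}) :
  \prod_i (d - #|forb i|) <=
  #|[set w : #|J|.-tuple 'I_d |
      [forall (i | leaf S j i), dye j w i \notin forb i]]|.
Proof.
have := greedy_avoid_card (home S j) forb (enum_uniq (leaf S j))
  (@roomy_leaf j) (size_enum_leaf j).
have -> : [set w : #|J|.-tuple 'I_d | all (fun i => greedy (home S j) (pool S j)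
      (enum (leaf S j)) w [::] i \notin forb i) (enum (leaf S j))]
    = [set w : #|J|.-tuple 'I_d |
      [forall (i | leaf S j i), dye j w i \notin forb i]].
  apply/setP => w; rewrite !inE; apply/allP/forall_inP => ok i.
    by move=> ji; apply: ok; rewrite mem_enum.
  by rewrite mem_enum; apply: ok.
apply: leq_trans; rewrite (bigID (leaf S j)) /= -big_enum /=.
rewrite leq_mul2l; apply/orP; right.
rewrite -cardE -(cardC (leaf S j)) addKn -prod_nat_const.
rewrite [leqRHS](eq_bigl (fun i => ~~ leaf S j i)) //.
by apply: leq_prod => i _; exact: leq_subr.
Qed.

End SchemeColouring.

(** * Vertices missed by few paths *)

Lemma sum_card_fibre (J Col : finType) (Q : seq (Col * J)) :
  \sum_i #|[set c | (c, i) \in Q]| <= size Q.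
Proof.
apply: leq_trans (card_size Q); rewrite -sum1_card.
under eq_bigr do rewrite -sum1dep_card.
rewrite (pair_big_dep xpredT (fun i c => (c, i) \in Q)) /=.
rewrite (reindex (fun q : Col * J => (q.2, q.1))) /=; last first.
  by exists (fun u : J * Col => (u.2, u.1)) => -[].
by rewrite leq_eqVlt; apply/orP; left; apply/eqP/eq_bigl => -[].
Qed.

Lemma count_flatten_le (T : eqType) (a b : pred T) (P : seq (seq T)) :
    (forall p, p \in P -> count a p <= (count b p).+1) ->
  count a (flatten P) <= count b (flatten P) + size P.
Proof.
elim: P => //= p P IHp le_p; rewrite !count_cat.
have := le_p p (mem_head _ _).
suff : count a (flatten P) <= count b (flatten P) + size P by lia.
by apply: IHp => p' p'P; apply: le_p; rewrite inE p'P orbT.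
Qed.

Section Counting.
Variables (J Col : finType) (d z : nat) (S : scheme J Col d).
Notation vertex := (vertex J d z).
Notation part := (@part J d z).
Notation word := (@word J d z).

Lemma card_safe_ge (X : {set J}) (forb : J -> {set Col}) :
  (#|J| - #|X|) * (\prod_i (d - #|forb i|) * z) <=
  #|[set x : vertex | (part x \notin X) &&
      [forall (i | leaf S (part x) i), dye S (part x) (word x) i \notin forb i]]|.
Proof.
rewrite -sum1dep_card (partition_big part (fun j => j \notin X)) /=; last first.
  by move=> x /andP[].
have -> : #|J| - #|X| = #|~: X| by rewrite -(cardsC X) addKn.
rewrite -sum1_card big_distrl /=.
rewrite [leqRHS](eq_bigl (fun j => j \in ~: X)); last by move=> j; rewrite inE.
apply: leq_sum => j; rewrite inE mul1n => jX.
apply: leq_trans (leq_mul (dye_avoid_card S j forb) (leqnn z)) _.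
rewrite -(card_part z j) -sum1dep_card leq_eqVlt; apply/orP; left; apply/eqP.
apply: eq_bigl => x; rewrite andbC.
by case: eqVneq => [->|]; rewrite ?jX ?andbF ?andbT //=.
Qed.

(** The safe vertices, whose chosen components are all around overloaded
    centres, fill at least [2 * L + 1] parts, while at most [2 * L] parts are
    overloaded.  Each path covers at most one more safe vertex than overloaded
    ones, so all but [r] vertices of one whole part's worth are missed. *)
Theorem scheme_uncovered (r L : nat) (P : seq (seq vertex)) :
    0 < d -> r <= L * d -> 16 ^ L * L.*2.+1 <= #|J| - r ->
    (forall p, p \in P ->
      exists k, sorted (fun x y => shade S x y == k) p) ->
    uniq (flatten P) -> size P <= r ->
  d ^ #|J| * z <= #|[set x | ~~ has (fun p => x \in p) P]| + r.
Proof.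
move=> d_gt0 r_le J_ge mono uniqP sizeP.
have J_gt0 : 0 < #|J| by have := expn_gt0 16 L; nia.
have [j0 _] := card_gt0P J_gt0.
(* Each path of P lies in a component, so the default is never taken. *)
pose comp (p : seq vertex) :=
  odflt (home S j0, j0) [pick q | sorted (component_edge S q) p].
have compP p : p \in P -> sorted (component_edge S (comp p)) p.
  move=> /mono[k /(monochromatic_component j0)[q qp]].
  by rewrite /comp; case: pickP => //= /(_ q); rewrite qp.
pose Q := map comp P.
pose used i := [set c | (c, i) \in Q].
have sum_used : \sum_i #|used i| <= r.
  by apply: leq_trans (sum_card_fibre Q) _; rewrite size_map.
pose X := [set i | used i != set0].
pose W := [set i | d < #|used i|.*2].
pose forb i := if i \in W then set0 else used i.
have X_le : #|X| <= r.
  apply: leq_trans sum_used; rewrite -sum1_card big_mkcond /=.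
  by apply: leq_sum => i _; rewrite inE -card_gt0; case: (#|used i|).
have W_le : #|W| <= L.*2.
  rewrite -(leq_pmul2r d_gt0); apply: (@leq_trans (\sum_i #|used i|.*2)).
    rewrite -sum_nat_const big_mkcond /=.
    by apply: leq_sum => i _; rewrite inE; case: ltnP => // /ltnW.
  suff -> : \sum_i #|used i|.*2 = (\sum_i #|used i|).*2 by lia.
  by rewrite -mul2n big_distrr /=; apply: eq_bigr => i _; rewrite mul2n.
have prod_ge : d ^ #|J| <= 16 ^ L * \prod_i (d - #|forb i|).
  apply: prod_subn_ge => // [i|].
    by rewrite /forb inE; case: ltnP => //; rewrite cards0.
  apply: leq_trans r_le; apply: leq_trans sum_used; apply: leq_sum => i _.
  by rewrite /forb; case: ifP => //; rewrite cards0.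
pose safe (x : vertex) := (part x \notin X) &&
  [forall (i | leaf S (part x) i), dye S (part x) (word x) i \notin forb i].
pose overloaded (x : vertex) := part x \in W.
have safe_overloaded p : p \in P -> count safe p <= (count overloaded p).+1.
  move=> pP; have := compP p pP; case E: (comp p) => [c i].
  apply: path_count_le => x y; have qQ : (c, i) \in Q by rewrite -E map_f.
  move=> exy /andP[xX /forall_inP avoid].
  have xi : part x != i.
    apply: contraNneq xX => ->; rewrite inE; apply/set0Pn; exists c.
    by rewrite inE.
  have [lxi dx yi] := leaf_edge_centre xi exy.
  rewrite /overloaded yi; have := avoid i lxi; rewrite /forb dx.
  by case: ifP => // _; rewrite inE qQ.
have safe_flat := count_flatten_le safe_overloaded.
(* Disjointness of the paths enters here. *)
have overloaded_le : count overloaded (flatten P) <= #|W| * (d ^ #|J| * z).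
  rewrite -card_parts -size_filter cardE; apply: uniq_leq_size.
    exact: filter_uniq.
  by move=> x; rewrite mem_filter mem_enum inE => /andP[].
have safe_le : #|[set x | safe x]| <=
    #|[set x | ~~ has (fun p => x \in p) P]| + count safe (flatten P).
  have /subset_leq_card : [set x | safe x] \subset
      [set x | ~~ has (fun p => x \in p) P] :|: [set x in filter safe (flatten P)].
    apply/subsetP => x; rewrite !inE mem_filter => -> /=.
    rewrite -implybE; apply/implyP => /hasP[p pP xp].
    by apply/flattenP; exists p.
  move/leq_trans; apply; apply: leq_trans (leq_card_setU _ _) _.
  rewrite leq_add2l -size_filter.
  by apply: leq_trans (card_size (filter safe (flatten P))); rewrite cardsE.
have := card_safe_ge X forb; rewrite -/safe => safe_ge.
set D := d ^ #|J| in prod_ge overloaded_le *; set Pr := \prod_i _ in prod_ge safe_ge.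
have step : L.*2.+1 * (D * z) <= #|[set x | safe x]|.
  apply: leq_trans safe_ge; rewrite !mulnA leq_mul2r; apply/orP; right.
  apply: (@leq_trans (16 ^ L * L.*2.+1 * Pr)).
    by rewrite (mulnC (16 ^ L)) -mulnA leq_mul2l prod_ge orbT.
  by rewrite leq_mul2r; apply/orP; right; apply: leq_trans J_ge _; rewrite leq_sub2l.
have : #|W| * (D * z) <= L.*2 * (D * z) by rewrite leq_mul2r W_le orbT.
move=> W_overloaded; rewrite -(leq_add2r (L.*2 * (D * z))).
move: step; rewrite mulSn => /leq_trans/(_ safe_le)/leq_trans -> //.
rewrite -addnA leq_add2l (leq_trans safe_flat) // addnC leq_add //.
exact: leq_trans overloaded_le W_overloaded.
Qed.

End Counting.

(** * More parts than colours *)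

Lemma exists_injection (T U : finType) :
  #|T| <= #|U| -> exists f : T -> U, injective f.
Proof.
move=> le_TU; exists (fun x => enum_val (widen_ord le_TU (enum_rank x))).
by move=> x y /enum_val_inj/(congr1 val)/=/val_inj/enum_rank_inj.
Qed.

(** Colours of the scheme become elements of ['I_r] through an injection, and
    vertices are numbered by [enum_val]; paths and what they miss correspond. *)
Lemma scheme_edge_colouring (J Col : finType) (d z r L : nat)
    (S : scheme J Col d) :
    0 < d -> #|Col| <= r -> r <= L * d -> 16 ^ L * L.*2.+1 <= #|J| - r ->
  exists c : edge_colouring r #|vertex J d z|,
    forall P, disjoint_monochromatic_paths c P -> size P <= r ->
      d ^ #|J| * z <= #|uncovered P| + r.
Proof.
move=> d_gt0; rewrite -[r in #|Col| <= r]card_ord => /exists_injection[f f_inj].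
move=> r_le J_ge.
pose col (x y : 'I_#|vertex J d z|) := f (shade S (enum_val x) (enum_val y)).
have colC x y : col x y = col y x by rewrite /col shadeC.
exists (EdgeColouring colC) => P [mono uniqP] sizeP.
pose P' := map (map (@enum_val _ (vertex J d z))) P.
have uniqP' : uniq (flatten P').
  by rewrite -map_flatten (map_inj_uniq enum_val_inj).
have monoP' p' : p' \in P' ->
    exists k, sorted (fun x y => shade S x y == k) p'.
  case/mapP => p /mono[p0 _ [k]] mono_p ->{p'}; case: p p0 mono_p => // x [|y p] _.
    by exists (shade S (enum_val x) (enum_val x)).
  move=> mono_p; have /andP[/= /eqP xy _] := mono_p.
  exists (shade S (enum_val x) (enum_val y)).
  have shade_xy (x' y' : 'I_#|vertex J d z|) : col x' y' == k ->
      shade S (enum_val x') (enum_val y') == shade S (enum_val x) (enum_val y).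
    by rewrite -xy (inj_eq f_inj).
  exact: (homo_sorted (f := enum_val) shade_xy _ mono_p).
have := scheme_uncovered d_gt0 r_le J_ge monoP' uniqP'.
rewrite size_map => /(_ sizeP); congr (_ <= _ + r).
rewrite -(card_imset (mem (uncovered P)) (@enum_val_inj _ (vertex J d z))).
apply: eq_card => x; rewrite -(enum_rankK x) mem_imset; last exact: enum_val_inj.
rewrite !inE has_map; congr (~~ _); apply: eq_has => p /=.
by rewrite mem_map //; exact: enum_val_inj.
Qed.

Lemma card_alternating (T : finType) (f : pred T) (g : T -> T) :
  involutive g -> (forall x, f (g x) = ~~ f x) -> #|f|.*2 = #|T|.
Proof.
move=> gK fg; rewrite -(cardC f) -addnn; congr (_ + _).
rewrite -(card_image (inv_inj gK)); apply: eq_card => x; rewrite !inE.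
by rewrite -{1}(gK x) mem_image ?unfold_in ?fg //; exact: inv_inj.
Qed.

Section Parity.
Variable T : finType.
Implicit Types (u v : {set T}) (t : T).

Definition toggle t v := if t \in v then v :\ t else t |: v.

Lemma toggleK t : involutive (toggle t).
Proof.
move=> v; rewrite /toggle; case: (boolP (t \in v)) => tv; rewrite !inE eqxx /=.
  exact: setD1K.
by rewrite setU1K.
Qed.

Lemma odd_toggle u t v :
  odd #|u :&: toggle t v| = (t \in u) (+) odd #|u :&: v|.
Proof.
rewrite /toggle; case: (boolP (t \in v)) => tv.
  rewrite (cardsD1 t (u :&: v)) inE tv andbT -setIDA oddD oddb addbA addbb.
  by rewrite addFb.
rewrite (cardsD1 t) !inE eqxx andbT oddD oddb; congr (_ (+) odd #|pred_of_set _|).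
apply/setP => s; rewrite !inE; case: eqVneq => //= ->.
by rewrite (negPf tv) andbF.
Qed.

(** Toggling an element of the symmetric difference of [u1] and [u2] changes
    exactly one of the two parities. *)
Lemma card_parity_differ u1 u2 : u1 != u2 ->
  #|[set v | odd #|u1 :&: v| != odd #|u2 :&: v|]|.*2 = 2 ^ #|T|.
Proof.
move=> ne; rewrite -[in RHS]cardsT -card_powerset powersetT cardsT cardsE.
have /existsP[t ne_t] : [exists t, (t \in u1) != (t \in u2)].
  apply: contraR ne => /existsPn same; apply/eqP/setP => t.
  by have := same t; rewrite negbK => /eqP.
apply: (card_alternating (@toggleK t)) => v; rewrite !odd_toggle.
by move: ne_t; case: (t \in u1); case: (t \in u2) => //;
  case: (odd _); case: (odd _).
Qed.

End Parity.

Section GridScheme.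
Variables (g a : nat) (T : finType).
Let half := (bool * 'I_a.*2)%type.
Variable code : half -> {set T}.
Hypothesis code_inj : injective code.
Hypothesis T_large : 10 * a <= 2 ^ #|T|.

Definition grid_part : finType := ('I_g * half)%type.
Definition grid_colour : finType := ('I_g * 'I_(3 * a) + bool * {set T})%type.
Implicit Types i j : grid_part.

(** Between different groups, the half of the leaf determines which half of the
    other group provides its centres.  The rule depends on the order of the two
    groups, and this orients the four pairs of halves as a directed cycle. *)
Definition grid_leaf j i : bool :=
  if i.1 == j.1 then enum_rank i.2 < enum_rank j.2
  else if i.1 < j.1 then i.2.1 == j.2.1 else i.2.1 != j.2.1.

(** The sign [v.1] balances the parity code: for codes differing at [v.2],
    exactly one of the two signs makes the first part a centre and the second
    part not. *)
Definition grid_own i : {set grid_colour} :=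
  [set c | match c with
           | inl u => u.1 == i.1
           | inr v => odd #|code i.2 :&: v.2| (+) v.1
           end].

Definition grid_pool j i : {set grid_colour} :=
  if i.1 == j.1 then grid_own i :\: grid_own j
  else [set c | if c is inl u then u.1 == i.1 else false].

Definition grid_home i : grid_colour := inr (true, set0).

Lemma grid_leaf_tournament i j : i != j -> grid_leaf i j = ~~ grid_leaf j i.
Proof.
move: i j => [u x] [v y] ne; rewrite /grid_leaf /= [v == u]eq_sym.
case: eqVneq => [uv|uv].
  rewrite -leqNgt [RHS]leq_eqVlt; case: eqVneq => [/ord_inj/enum_rank_inj xy|//].
  by rewrite uv xy eqxx in ne.
rewrite [y.1 == _]eq_sym; case: (ltngtP u v) => [||/ord_inj/eqP]; rewrite ?negbK //.
by rewrite (negPf uv).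
Qed.

Lemma grid_home_own i : grid_home i \in grid_own i.
Proof. by rewrite inE /= setI0 cards0. Qed.

Lemma grid_pool_sub j i :
  grid_leaf j i -> grid_pool j i \subset grid_own i :\: grid_own j.
Proof.
move=> _; rewrite /grid_pool; case: eqVneq => // ne.
apply/subsetP => -[u|v]; rewrite !inE //.
by move=> /eqP->; rewrite ne eqxx.
Qed.

Lemma grid_pool_disjoint j i1 i2 :
  i1.1 == j.1 -> i2.1 != j.1 -> [disjoint grid_pool j i1 & grid_pool j i2].
Proof.
rewrite /grid_pool => e1 /negPf ->; rewrite e1.
apply/pred0P => -[u|v]; rewrite /= !inE ?andbF //.
by rewrite (eqP e1) andNb.
Qed.

(** Inside a group, two codes differ in parity on half of the [2 ^ #|T|] sets,
    which is at least [5 * a], and at most [4 * a] centres compete.  Towards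
    another group, the [2 * a] parts of one half share [3 * a] colours. *)
Lemma grid_pool_room j i : grid_leaf j i ->
  a + #|[set i1 | grid_leaf j i1 && overlap (grid_pool j) i i1]| <= #|grid_pool j i|.
Proof.
case: (boolP (i.1 == j.1)) => [eij|nij] ji.
  have le_half : #|[set i1 | grid_leaf j i1 && overlap (grid_pool j) i i1]| <= 4 * a.
    apply: (@leq_trans #|setX [set j.1] [set: half]|); last first.
      by rewrite cardsX cards1 cardsT card_prod card_bool card_ord; lia.
    apply/subset_leq_card/subsetP => -[u x]; rewrite !inE andbT => /andP[_].
    apply: contraTT => nu; rewrite /overlap negbK disjoint_sym.
    exact: grid_pool_disjoint.
  have ne : code i.2 != code j.2.
    rewrite (inj_eq code_inj); apply: contraTneq ji => eij2.
    by rewrite /grid_leaf eij eij2 ltnn.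
  have := card_parity_differ ne; set D := [set v | _] => cardD.
  pose f (v : {set T}) : grid_colour := inr (~~ odd #|code i.2 :&: v|, v).
  have f_inj : injective f by move=> v1 v2 [].
  have : #|D| <= #|grid_pool j i|.
    rewrite -(card_imset _ f_inj); apply/subset_leq_card/subsetP => c.
    case/imsetP => v; rewrite inE => vD ->; rewrite /grid_pool eij !inE /=.
    by move: vD; case: (odd _); case: (odd _).
  by lia.
have -> : #|grid_pool j i| = 3 * a.
  rewrite /grid_pool (negPf nij) -[RHS]card_ord.
  rewrite -[RHS](card_imset _ (f := fun s : 'I_(3 * a) => inl (i.1, s) : grid_colour)).
    apply: eq_card => -[[u s]|v]; rewrite !inE /=; last by apply/esym/imsetP => -[].
    apply/eqP/imsetP => [->|[s' _ [-> _]] //]; by exists s.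
  by move=> s1 s2 [].
suff : #|[set i1 | grid_leaf j i1 && overlap (grid_pool j) i i1]| <= 2 * a by lia.
pose b := if i.1 < j.1 then j.2.1 else ~~ j.2.1.
apply: (@leq_trans #|setX [set i.1] (setX [set b] [set: 'I_a.*2])|); last first.
  by rewrite !cardsX !cards1 cardsT card_ord; lia.
apply/subset_leq_card/subsetP => -[u [b1 s]]; rewrite !inE andbT => /andP[lf ov].
have nu : u != j.1.
  apply: contraTneq ov => eu; rewrite /overlap negbK.
  by apply: grid_pool_disjoint; rewrite ?eu.
have ui : u == i.1.
  apply: contraTT ov => ui; rewrite negbK; apply/pred0P.
  case=> [u'|v]; rewrite /= /grid_pool.
    rewrite (negPf nij) (negPf nu) !inE /=; case: eqVneq => //= ->.
    exact: negPf.
  by rewrite (negPf nij) (negPf nu) !inE.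
rewrite ui /=; move: lf; rewrite /grid_leaf (negPf nu) /= (eqP ui) /b.
by case: ifP => _; case: (b1) (j.2.1) => -[].
Qed.

Definition grid_scheme : scheme grid_part grid_colour a :=
  Scheme grid_leaf_tournament grid_home_own grid_pool_sub grid_pool_room.

End GridScheme.

Local Open Scope ring_scope.

(** Here [m] is the number of parts and [D * z] the size of each of them.  The
    constants are those of 100 groups: [300 * a] colours for pairs in different
    groups and [2 * 2 ^ k <= 40 * a] for pairs in the same group, against
    [400 * a] parts; at least [39 * a] parts are then not the centre of any of
    [r] given components. *)
Lemma grid_colouring (r a L : nat) :
    L = 361%N -> (0 < a)%N -> (360 * a <= r)%N -> (r <= L * a)%N ->
    (16 ^ L * L.*2.+1 <= 39 * a)%N ->
  exists m D : nat, (0 < m)%N /\ (0 < D)%N /\ forall z : nat,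
    exists n : nat, n = (m * (D * z))%N /\
      exists c : edge_colouring r n, forall P : seq (seq 'I_n),
        disjoint_monochromatic_paths c P -> (size P <= r)%N ->
        (D * z <= #|uncovered P| + r)%N.
Proof.
move=> LE a_gt0 r_ge r_le a_large.
pose k := up_log 2 (10 * a).
have [k_lt k_ge] : (2 ^ k.-1 < 10 * a)%N /\ (10 * a <= 2 ^ k)%N.
  by apply/andP; apply: up_log_bounds => //; lia.
have k_gt0 : (0 < k)%N by case: (k) k_ge; rewrite // expn0; lia.
have k_le : (2 ^ k <= 20 * a)%N by rewrite -(prednK k_gt0) expnS; lia.
have card_sets : #|{set 'I_k}| = (2 ^ k)%N.
  by rewrite -cardsT -powersetT card_powerset cardsT card_ord.
have [|code code_inj] := @exists_injection (bool * 'I_a.*2)%type {set 'I_k}.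
  by rewrite card_sets card_prod card_bool card_ord; lia.
have k_ge' : (10 * a <= 2 ^ #|'I_k|)%N by rewrite card_ord.
pose S := grid_scheme 100 code_inj k_ge'.
have cardJ : #|grid_part 100 a| = (400 * a)%N.
  by rewrite !card_prod card_bool !card_ord; lia.
have cardC : (#|grid_colour 100 a 'I_k| <= r)%N.
  by rewrite card_sum !card_prod card_bool !card_ord card_sets; lia.
have J_ge : (16 ^ L * L.*2.+1 <= #|grid_part 100 a| - r)%N.
  by apply: leq_trans a_large _; rewrite cardJ; lia.
exists #|grid_part 100 a|, (a ^ #|grid_part 100 a|)%N; split; first by rewrite cardJ; lia.
split=> [|z]; first by rewrite expn_gt0 a_gt0.
have [c cP] := scheme_edge_colouring z S a_gt0 cardC r_le J_ge.
exists #|vertex (grid_part 100 a) a z|; split; last by exists c.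
by rewrite !card_prod card_tuple !card_ord -mulnA.
Qed.

Theorem theorem1p4 (R : realType) :
  exists r0 : nat, forall r : nat, (r0 <= r)%N ->
    exists eta : R, 0 < eta /\
      forall N : nat, exists n : nat, (N <= n)%N /\
        exists c : edge_colouring r n,
          forall P : seq (seq 'I_n),
            disjoint_monochromatic_paths c P -> (size P <= r)%N ->
            eta * n%:R <= #|uncovered P|%:R.
Proof.
(* L is kept as a variable so that the power 16 ^ L is never evaluated. *)
have [L LE] : exists L, L = 361%N by exists 361%N.
exists (360 * (360 + 16 ^ L * L.*2.+1))%N => r r_ge.
pose a := (r %/ 360)%N.
have a_ge : (360 + 16 ^ L * L.*2.+1 <= a)%N by rewrite leq_divRL // mulnC.
have a360 : (360 <= a)%N by apply: leq_trans a_ge; apply: leq_addr.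
have a_large : (16 ^ L * L.*2.+1 <= 39 * a)%N.
  apply: (@leq_trans a); last by rewrite leq_pmull.
  by apply: leq_trans a_ge; apply: leq_addl.
have [|||m [D [m_gt0 [D_gt0 col]]]] :=
  grid_colouring LE (r := r) (a := a) _ _ _ a_large.
- exact: leq_trans a360.
- by rewrite mulnC leq_divM.
- have := divn_eq r 360; have := @ltn_pmod r 360 isT; rewrite -/a LE; lia.
have mR : 0 < m%:R :> R by rewrite ltr0n.
exists (2 * m%:R)^-1; split; first by rewrite invr_gt0 mulr_gt0.
move=> N.
(* With parts of size at least 2 * r, one vertex per path is at most half a
   part. *)
have [n [nE [c cP]]] := col (N + r.*2)%N.
exists n; split.
  rewrite nE mulnA; apply: (@leq_trans (N + r.*2)%N); first exact: leq_addr.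
  by rewrite leq_pmull // muln_gt0 m_gt0.
exists c => P Ppaths Psize; have := cP P Ppaths Psize.
set E := (D * _)%N in nE * => E_le.
have E_ge : (r.*2 <= E)%N by apply: leq_trans (leq_pmull _ D_gt0); lia.
set u := #|uncovered P| in E_le *.
rewrite nE natrM invfM -mulrA mulKf ?lt0r_neq0 //.
rewrite ler_pdivrMl // -natrM ler_nat; lia.
Qed.
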